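(* Let $(\zeta_n)$ be the sequence $$1,2,4,6,12,18,24,\ldots,n!,\,2\cdot n!,\,3\cdot n!,\ldots,n\cdot n!,\,(n+1)!,\ldots,$$ that is, the increasing enumeration of the set $\{r\cdot n! : n\ge 1,\ 1\le r\le n\}$. Then $|t^s_{(\zeta_n)}(\mathbb{T})|=\mathfrak{c}$.
   Context: $\mathbb{T}=\mathbb{R}/\mathbb{Z}$ is the circle group; for real $x$, $\|x\|$ denotes the distance from $x$ to the nearest integer (this is well defined on $\mathbb{T}$). $\mathfrak{c}$ is the cardinality of the continuum. Density: for $A\subseteq\mathbb{N}$, $\overline{d}(A)=\limsup_{n\to\infty}\frac{|A\cap[0,n-1]|}{n}$ and $\underline{d}(A)=\liminf_{n\to\infty}\frac{|A\cap[0,n-1]|}{n}$; if they are equal the common value is the natural density $d(A)$. For a sequence of integers $(u_n)$, the statistically characterized subgroup is $t^s_{(u_n)}(\mathbb{T})=\{x\in\mathbb{T}: u_nx\to 0 \text{ statistically}\}$, where $u_nx\to0$ statistically means that for every $\varepsilon>0$ the set $\{n:\|u_nx\|\ge\varepsilon\}$ has natural density $0$. *)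

(* Defs.v *)
From HB Require Import structures.
From mathcomp Require Import all_boot all_order all_algebra.
From mathcomp Require Import generic_quotient ring_quotient.
From mathcomp Require Import all_classical all_reals all_analysis.
Set Implicit Arguments.
Unset Strict Implicit.
Unset Printing Implicit Defensive.
Import Order.TTheory GRing.Theory Num.Theory.
Import numFieldNormedType.Exports.
Local Open Scope classical_set_scope.
Local Open Scope ring_scope.
Local Open Scope quotient_scope.

(* R/Z, as the quotient Z-module of R by Num.int (int_num_subdef is the
   predicate behind the qualifier Num.int, which carries the closure instances). *)
Definition circle (R : realType) :=
  Quotient.quot (GRing.ZmodClosed.clone R (@Num.int_num_subdef R) _).

Definition dist_int (R : realType) (x : R) : R :=
  inf [set `|x - k%:~R| | k in [set: int]].

(* Independent of the representative, see circle_norm_pi. *)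
Definition circle_norm (R : realType) (x : circle R) : R := dist_int (repr x).

Lemma dist_intD (R : realType) (x : R) (k : int) :
  dist_int (x + k%:~R) = dist_int x.
Proof.
rewrite /dist_int; congr inf; apply/seteqP; split=> _ [j _ <-].
  by exists (j - k) => //; rewrite intrB opprB addrA.
by exists (j + k) => //; rewrite intrD opprD addrACA subrr addr0.
Qed.

Lemma circle_norm_pi (R : realType) (x : R) :
  circle_norm (\pi_(circle R) x) = dist_int x.
Proof.
have : repr (\pi_(circle R) x) == x %[mod circle R] by rewrite reprK.
rewrite -Quotient.idealrBE => /intrP[k xk].
by rewrite /circle_norm -(subrK x (repr _)) xk addrC dist_intD.
Qed.

(* The value at n = 0 is 0 / 0 = 0, which does not affect the limits. *)
Definition counting_ratio (R : realType) (A : set nat) (n : nat) : R :=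
  #|[pred i : 'I_n | (i : nat) \in A]|%:R / n%:R.

Definition upper_density (R : realType) (A : set nat) : R :=
  limn_sup (@counting_ratio R A).

Definition lower_density (R : realType) (A : set nat) : R :=
  limn_inf (@counting_ratio R A).

Definition has_density (R : realType) (A : set nat) (d : R) : Prop :=
  upper_density R A = d /\ lower_density R A = d.

Definition stat_cvg0 (R : realType) (y : nat -> circle R) : Prop :=
  forall eps : R, 0 < eps ->
    has_density [set n | eps <= circle_norm (y n)] (0 : R).

Definition stat_char_subgroup (R : realType) (u : nat -> int) :
    set (circle R) :=
  [set x | stat_cvg0 (fun n => x *~ u n)].

(* The first k blocks n!, 2 n!, ..., n n! (n = 1, ..., k), concatenated. *)
Definition zeta_blocks (k : nat) : seq nat :=
  [seq (r * n`!)%N | n <- iota 1 k, r <- iota 1 n].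

(* Indexed from 0: zeta 0 = 1, zeta 1 = 2, zeta 2 = 4, zeta 3 = 6, ...
   The first i.+1 blocks contain at least i.+1 terms. *)
Definition zeta (i : nat) : nat := nth 0%N (zeta_blocks i.+1) i.

Lemma zeta_blocksS k : zeta_blocks k.+1 =
  zeta_blocks k ++ [seq (r * k.+1`!)%N | r <- iota 1 k.+1].
Proof.
by rewrite /zeta_blocks -[in LHS](addn1 k) iotaD map_cat flatten_cat /= cats0.
Qed.

Lemma zeta_blocks_prefix k l : prefix (zeta_blocks k) (zeta_blocks (k + l)).
Proof.
elim: l => [|l IH]; first by rewrite addn0 prefix_refl.
by rewrite addnS zeta_blocksS (prefix_trans IH) // prefix_prefix.
Qed.

Lemma size_zeta_blocks k : (k <= size (zeta_blocks k))%N.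
Proof.
by case: k => // k; rewrite zeta_blocksS size_cat size_map size_iota leq_addl.
Qed.

Lemma mem_zeta_blocks k m : reflect
  (exists n r, [/\ (1 <= n <= k)%N, (1 <= r <= n)%N & m = (r * n`!)%N])
  (m \in zeta_blocks k).
Proof.
apply: (iffP allpairsPdep) => -[n [r]]; rewrite ?mem_iota ?add1n ?ltnS.
  by case=> *; exists n, r.
by case=> *; exists n, r; rewrite !mem_iota !add1n !ltnS.
Qed.

Lemma zetaE k i :
  (i < size (zeta_blocks k))%N -> zeta i = nth 0%N (zeta_blocks k) i.
Proof.
have H a b : (a <= b)%N -> (i < size (zeta_blocks a))%N ->
  nth 0%N (zeta_blocks b) i = nth 0%N (zeta_blocks a) i.
  move=> ab ia; have := zeta_blocks_prefix a (b - a); rewrite subnKC //.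
  by case/prefixP => s ->; rewrite nth_cat ia.
move=> ik; have [le|/ltnW le] := leqP k i.+1; rewrite /zeta; first exact: H.
by rewrite (H _ _ le) // size_zeta_blocks.
Qed.

Lemma zeta_blocks_sorted k : sorted ltn (zeta_blocks k).
Proof.
rewrite (sorted_pairwise ltn_trans).
elim: k => // k IH; rewrite zeta_blocksS pairwise_cat IH.
apply/and3P; split=> //; last first.
  rewrite -(sorted_pairwise ltn_trans).
  apply: homo_sorted (iota_ltn_sorted 1 k.+1) => a b ab.
  by rewrite /= ltn_pmul2r ?fact_gt0.
apply/allrelP => a b.
move=> /mem_zeta_blocks [n [r [/andP[n0 nk] /andP[r0 rn] ->]]].
move=> /mapP[s].
rewrite mem_iota => /andP[s0 _] ->.
apply: (@leq_trans n.+1`!).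
  by rewrite factS ltn_pmul2r ?fact_gt0.
apply: (@leq_trans k.+1`!); first by rewrite leq_fact.
by rewrite leq_pmull.
Qed.

Lemma zeta_increasing : {homo zeta : i j / (i < j)%N}.
Proof.
move=> i j ij; have sj := size_zeta_blocks j.+1.
have si : (i < size (zeta_blocks j.+1))%N by exact: leq_trans (ltnW ij) sj.
rewrite (zetaE si) (zetaE sj).
have H := sorted_ltn_nth ltn_trans 0%N (zeta_blocks_sorted j.+1).
exact: H.
Qed.

Lemma range_zeta : range zeta =
  [set m | exists n r, [/\ (1 <= n)%N, (1 <= r <= n)%N & m = (r * n`!)%N]].
Proof.
apply/seteqP; split=> [_ [i _ <-]|m [n [r [n0 rn ->]]]] /=.
  have /mem_zeta_blocks [n [r [/andP[? _] ? ?]]] : zeta i \in zeta_blocks i.+1.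
    exact/mem_nth/size_zeta_blocks.
  by exists n, r.
have mB : (r * n`!)%N \in zeta_blocks n.
  by apply/mem_zeta_blocks; exists n, r; rewrite n0 leqnn.
exists (index (r * n`!)%N (zeta_blocks n)) => //.
by rewrite (@zetaE n) ?index_mem // nth_index.
Qed.

(* Main.v *)
Require Import Defs.
From mathcomp Require Import all_boot all_order all_algebra.
From mathcomp Require Import generic_quotient.
From mathcomp Require Import all_classical all_reals all_analysis.
From mathcomp Require Import zify ring lra.
Import Order.TTheory GRing.Theory Num.Theory.
Import numFieldNormedType.Exports.

(** The circle has at most continuum many points, so by Cantor-Bernstein it is
enough to inject the reals into the subgroup.  The members exhibited are the
classes of the numbers e_A = sum_{n in A} 1/n!, where A is a set of powers of 2.

Membership.  The terms of zeta come in blocks r n!, 1 <= r <= n.  Multiplying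
e_A by n! turns all the summands 1/i! with i <= n into integers.  When n+1 is
not in A the first of the remaining summands is at most 1/(n+2)!, and the tail
is bounded by 2/(n+2)!; hence r n! e_A is within 2/(n+1) of an integer for
every r <= n (dist_int_fact_sum).  So outside the blocks with n+1 in A, the
distances tend to 0.  These exceptional blocks are negligible because A is
sparse: the block of n = 2^a - 1 has length n, while about n^2/2 terms precede
it, and the lengths 2^a add up geometrically; so among the first N terms only
O(sqrt N) are exceptional (sparse_blocks_density0).

Injectivity.  If A and B first differ at k >= 2, with k in A, then e_A exceeds
e_B, since the tail of e_B after k is at most 2/(k+1)! < 1/k! (fact_sum_lt).
Keeping A above 2 confines e_A to [0, 1), where passing to the circle loses
nothing.  A real x is encoded by its Dedekind cut, a set of rationals, and hence
by a set of exponents of 2 (cut_code). *)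

Local Open Scope classical_set_scope.
Local Open Scope ring_scope.
Local Open Scope card_scope.

(** * Blocks of zeta and sets of density zero *)

Definition count_below (A : set nat) (n : nat) : nat := (\sum_(0 <= i < n) (i \in A))%N.

(** Since blocks 1, ..., k have total length 'C(k.+1, 2), this locates every
term: the block of multiples of k.+1`! starts at that index. *)
Lemma zeta_block k j : (j <= k)%N -> zeta ('C(k.+1, 2) + j) = (j.+1 * k.+1`!)%N.
Proof.
have sz m : size (zeta_blocks m) = 'C(m.+1, 2).
  elim: m => // m IH; rewrite zeta_blocksS size_cat IH size_map size_iota.
  by rewrite [RHS]binS bin1.
move=> jk.
rewrite (@zetaE k.+1) zeta_blocksS; last first.
  by rewrite size_cat sz size_map size_iota ltn_add2l ltnS.
rewrite nth_cat sz ltnNge leq_addr [~~ _]/= addKn.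
by rewrite (nth_map 0%N) ?size_iota // nth_iota.
Qed.

Lemma index_blockP i : exists k j, (j <= k)%N /\ i = ('C(k.+1, 2) + j)%N.
Proof.
elim: i => [|i [k [j [jk ->]]]]; first by exists 0%N, 0%N.
case: (ltnP j k) => [lt|ge]; first by exists k, j.+1; rewrite addnS.
exists k.+1, 0%N; split=> //; rewrite [in RHS]binS bin1; lia.
Qed.

(** A reformulation of zero density over the natural numbers: the counting
function is bounded by n / M + C for every M. *)
Lemma has_density0 (R : realType) (A : set nat) :
  (forall M, exists C, forall n, (count_below A n * M <= n + C)%N) ->
  has_density A (0 : R).
Proof.
move=> H.
have cE n : counting_ratio R A n = (count_below A n)%:R / n%:R :> R.
  congr (_%:R / _); rewrite /count_below big_mkord -sum1_card big_mkcond /=.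
  apply: eq_bigr => i _; rewrite -[i \in [pred _ | _]]/((i : nat) \in A).
  by case: (_ \in A).
have c0 : counting_ratio R A @ \oo --> (0 : R).
  apply/cvgrPdist_le => /= e e0.
  have [M Me] : exists M : nat, 2 / e < M.+1%:R :> R.
    by exists (Num.truncn (2 / e)); exact: truncnS_gt.
  have [C HC] := H M.+1.
  exists C.+1 => // n /= Cn.
  rewrite sub0r normrN cE ger0_norm ?divr_ge0 ?ler0n //.
  have n0 : (0 : R) < n%:R by rewrite ltr0n; lia.
  rewrite ler_pdivrMr //.
  have : (count_below A n)%:R * M.+1%:R <= 2 * n%:R :> R.
    by rewrite -!natrM ler_nat (leq_trans (HC n)) //; lia.
  move: Me; rewrite ltr_pdivrMr // => Me cM.
  have M0 : (0 : R) < M.+1%:R by rewrite ltr0n.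
  rewrite -(ler_pM2r M0) (le_trans cM) // [leRHS]mulrAC.
  by rewrite ler_wpM2r ?ler0n // mulrC ltW.
split.
- by rewrite /upper_density cvg_limn_supE; [exact/cvg_lim|exact: cvgP c0].
- by rewrite /lower_density cvg_limn_infE; [exact/cvg_lim|exact: cvgP c0].
Qed.

(** The exceptional set E may contain anything in the first K blocks, and later
only blocks of multiples of n! with n + 1 a power of 2 (here n = k.+1).  As the
lengths of such blocks form a geometric progression, their sum up to block k is
at most 2 * 2 ^ trunc_log 2 k.+1 <= 2 * k.+1, which is of the order of the
square root of the number of terms in these blocks. *)
Lemma sparse_blocks_density0 (R : realType) (E : set nat) (K : nat) :
  (forall k j, (K <= k)%N -> (j <= k)%N -> (forall a, k.+2 != 2 ^ a)%N ->
     ~ E ('C(k.+1, 2) + j)%N) ->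
  has_density E (0 : R).
Proof.
move=> EK.
have count_belowD n m : (count_below E (n + m) <= count_below E n + m)%N.
  rewrite /count_below (@big_cat_nat _ _ _ n) ?leq_addr //= leq_add2l.
  apply: leq_trans (_ : \sum_(n <= i < n + m) 1 <= m)%N.
    by apply: leq_sum => i _; case: (_ \in _).
  by rewrite sum_nat_const_nat muln1 addKn.
have count_below_le n : (count_below E n <= n)%N.
  by have := count_belowD 0%N n; rewrite [count_below E 0](_ : _ = 0%N) // /count_below big_geq.
have blockE k : 'C(k.+2, 2) = ('C(k.+1, 2) + k.+1)%N by rewrite binS bin1.
pose C0 := 'C(K.+1, 2).
have count_block_le k :
    (count_below E 'C(k.+1, 2) <= C0 + 2 * 2 ^ trunc_log 2 k.+1)%N.
  elim: k => [|k IH]; first by rewrite /count_below big_geq.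
  case: (ltnP k K) => [kK|Kk].
    apply: (@leq_trans C0); last exact: leq_addr.
    by apply: leq_trans (count_below_le _) _; apply: leq_bin2l.
  have mono := leq_trunc_log 2 (leqnSn k.+1).
  case: (pselect (exists a, k.+2 = 2 ^ a)%N) => [[a ka]|nP].
    (* The logarithm jumps to a.+1 exactly here, which pays for the block. *)
    rewrite blockE ka trunc_expnK //.
    case: a ka => // a ka.
    have la : (trunc_log 2 k.+1 <= a)%N.
      rewrite -ltnS -(@ltn_exp2l 2) // -ka ltnS; exact: trunc_logP.
    have := leq_pexp2l (isT : 0 < 2)%N la.
    have := count_belowD 'C(k.+1, 2) k.+1.
    move: ka IH; rewrite expnS; lia.
  have -> : count_below E 'C(k.+2, 2) = count_below E 'C(k.+1, 2).
    rewrite /count_below blockE (@big_cat_nat _ _ _ 'C(k.+1, 2)) ?leq_addr //=.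
    rewrite [X in (_ + X)%N]big1_seq ?addn0 // => i /andP[_].
    rewrite mem_index_iota => /andP[il ir].
    rewrite memNset // -(subnKC il); apply: EK => //; first lia.
    by move=> a; apply/eqP => ka; apply: nP; exists a.
  have := leq_pexp2l (isT : 0 < 2)%N mono; lia.
apply: has_density0 => M; exists (C0 * M + 4 * M + 2 * M * M)%N => n.
have [k [j [jk nE]]] := index_blockP n.
have cn : (count_below E n <= C0 + 2 * k.+2)%N.
  apply: leq_trans (_ : count_below E 'C(k.+2, 2) <= _)%N.
    rewrite /count_below [leqRHS](@big_cat_nat _ _ _ n) ?leq_addr //= nE blockE.
    by rewrite leq_add2l; lia.
  by rewrite (leq_trans (count_block_le _)) // leq_add2l leq_mul2l trunc_logP.
have nk : (k * k.+1 <= 2 * n)%N.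
  by have := mul_bin_diag k.+1 1; rewrite bin1 nE; lia.
have := leq_mul2r M (count_below E n) (C0 + 2 * k.+2); rewrite cn orbT => cM.
apply: leq_trans cM _.
(* The inequality 4 k M <= k^2 + 4 M^2 absorbs the term in k. *)
have : (4 * (k * M) <= k * k + 4 * (M * M))%N by case: (leqP k (2 * M)) => h; nia.
lia.
Qed.

(** * Sums of inverse factorials *)

Definition fact_term (R : realType) (A : set nat) (n : nat) : R :=
  (n \in A)%:R / n`!%:R.
Definition fact_sum (R : realType) (A : set nat) : R :=
  limn (series (fact_term R A)).

Section FactSum.
Variable R : realType.
Implicit Type A B : set nat.

Lemma fact_term_ge0 A n : 0 <= fact_term R A n.
Proof. by rewrite divr_ge0 ?ler0n. Qed.

(** Since 2 / n.+1`! <= 1 / n`!, a bound for the tail starting at n.+1 yields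
the one for the tail starting at n; the induction on the length therefore moves
the starting point.  At n = 0 the bound would fail, as e > 2. *)
Lemma fact_tail_le A n l : (0 < n)%N ->
  \sum_(n <= i < n + l) fact_term R A i <= 2 / n`!%:R.
Proof.
elim: l n => [|l IH] n n0.
  by rewrite addn0 big_geq // divr_ge0 ?ler0n.
have := IH n.+1 isT.
move=> Hs; rewrite big_ltn; last by lia.
rewrite -addSnnS.
have f0 : (0 : R) < n`!%:R by rewrite ltr0n fact_gt0.
apply: le_trans (_ : 1 / n`!%:R + 1 / n`!%:R <= _); last by rewrite -mulrDl.
rewrite lerD //; first by rewrite ler_pM2r ?invr_gt0 // lern1; case: (_ \in _).
apply: le_trans Hs _; rewrite factS natrM invfM mulrA ler_pM2r ?invr_gt0 //.
by rewrite ler_pdivrMr ?ltr0n // mul1r ler_nat.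
Qed.

Lemma fact_sum_cvg A : cvgn (series (fact_term R A)).
Proof.
apply: nondecreasing_is_cvgn.
  by apply/nondecreasing_seqP => n; rewrite seriesSr lerDl fact_term_ge0.
exists (fact_term R A 0 + 2) => _ [n _ <-].
case: n => [|n]; first by rewrite /series /= big_geq // addr_ge0 ?fact_term_ge0.
rewrite /series /= big_ltn // lerD2l.
by have := fact_tail_le A 1 n isT; rewrite divr1.
Qed.

Lemma fact_sum_ge A n : series (fact_term R A) n <= fact_sum R A.
Proof.
apply: limr_ge; first exact: fact_sum_cvg.
exists n => // m /= nm; rewrite -subr_ge0 sub_series_geq //.
by apply: sumr_ge0 => i _; exact: fact_term_ge0.
Qed.

Lemma fact_sum_le A n : (0 < n)%N ->
  fact_sum R A <= series (fact_term R A) n + 2 / n`!%:R.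
Proof.
move=> n0; apply: limr_le; first exact: fact_sum_cvg.
exists n => // m /= nm; rewrite -lerBlDl sub_series_geq //.
by rewrite -(subnKC nm) fact_tail_le.
Qed.

Lemma series_fact_int A n : series (fact_term R A) n.+1 * n`!%:R \is a Num.int.
Proof.
rewrite /series /= mulr_suml big_nat_cond rpred_sum // => i /andP[/andP[_ il] _].
rewrite /fact_term -mulrA rpredM ?rpred_nat //.
rewrite -(bin_fact (m := i) (n := n)) // !natrM mulrCA.
by rewrite [_^-1 * _]mulrA mulVf ?mul1r ?rpredM ?rpred_nat // pnatr_eq0 -lt0n fact_gt0.
Qed.

(** Because n.+1 is missing from A, the part of the sum that n`! does not make
integral is at most 2 / n.+2`!, and the factor r <= n.+2 costs only one of the
two orders of magnitude gained. *)
Lemma dist_int_fact_sum A n r : ~ A n.+1 -> (r <= n)%N ->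
  dist_int (fact_sum R A *~ (r * n`!)%N) <= 2 / n.+1%:R.
Proof.
move=> An rn.
have /intrP[z zE] := series_fact_int A n.
have sE : series (fact_term R A) n.+2 = series (fact_term R A) n.+1.
  by rewrite seriesSr /fact_term memNset // mul0r addr0.
apply: le_trans (_ : `|fact_sum R A *~ (r * n`!)%N - (z *+ r)%:~R| <= _).
  apply: ge_inf; last by exists (z *+ r).
  by exists 0 => _ [k _ <-].
pose t := fact_sum R A - series (fact_term R A) n.+1.
have t0 : 0 <= t by rewrite subr_ge0 fact_sum_ge.
have t2 : t <= 2 / n.+2`!%:R by rewrite lerBlDl -sE fact_sum_le.
have -> : fact_sum R A *~ (r * n`!)%N - (z *+ r)%:~R = t * (r%:R * n`!%:R).
  rewrite rmorphMn /= -zE.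
  rewrite -pmulrn -[_ *+ (r * _)]mulr_natr natrM.
  by rewrite -[_ *+ r]mulr_natr /t; ring.
rewrite ger0_norm ?mulr_ge0 ?ler0n //.
have f0 : (0 : R) < n`!%:R by rewrite ltr0n fact_gt0.
apply: le_trans (_ : (2 / n.+2`!%:R) * (n.+2%:R * n`!%:R) <= _).
  apply: (ler_pM t0 _ t2); first by rewrite -natrM ler0n.
  by rewrite ler_wpM2r ?ler0n // ler_nat; lia.
rewrite !factS !natrM.
rewrite le_eqVlt; apply/orP; left; apply/eqP.
by field; rewrite nat1r -natrD !pnatr_eq0 -!lt0n fact_gt0.
Qed.

(** Greedy comparison: the single summand 1 / k`! outweighs the whole tail
2 / k.+1`! beyond it.  The bound 1 < k makes this strict. *)
Lemma fact_sum_lt A B k : (1 < k)%N ->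
  (forall i, (i < k)%N -> A i <-> B i) -> A k -> ~ B k ->
  fact_sum R B < fact_sum R A.
Proof.
move=> k1 AB Ak Bk.
have sE : series (fact_term R A) k = series (fact_term R B) k.
  apply: eq_big_nat => i /andP[_ ik]; rewrite /fact_term; congr (_%:R / _).
  by congr nat_of_bool; apply/idP/idP; rewrite !inE => /(AB i ik).
have := fact_sum_ge A k.+1; have := @fact_sum_le B k.+1 isT.
rewrite !seriesSr sE /fact_term (mem_set Ak) (memNset Bk) mul0r addr0 mul1r => h1.
apply: lt_le_trans; apply: le_lt_trans h1 _; rewrite ltrD2l.
rewrite factS natrM invfM mulrA gtr_pMl ?invr_gt0 ?ltr0n ?fact_gt0 //.
by rewrite ltr_pdivrMr ?ltr0n // mul1r ltr_nat.
Qed.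

Lemma fact_sum_inj A B : A `<=` [set n | 1 < n]%N -> B `<=` [set n | 1 < n]%N ->
  fact_sum R A = fact_sum R B -> A = B.
Proof.
move=> A1 B1 e; apply: contrapT => nAB.
have ex : exists k, (k \in A) != (k \in B).
  apply: contrapT => nex; apply: nAB; apply/funext => k; apply/propext.
  have kE : (k \in A) = (k \in B).
    by apply/eqP; apply: contrapT => h; apply: nex; exists k; apply/negP.
  by split=> /mem_set; [rewrite kE|rewrite -kE]; rewrite inE.
case: (ex_minnP ex) => k kAB kmin.
have below i : (i < k)%N -> A i <-> B i.
  move=> ik; have /eqP iE : (i \in A) == (i \in B).
    by apply: contraTT ik => /kmin; rewrite -leqNgt.
  by split=> /mem_set; [rewrite iE|rewrite -iE]; rewrite inE.
move: kAB; case: (boolP (k \in A)); case: (boolP (k \in B)) => //.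
- rewrite inE notin_setE => nB Ak _.
  by have := @fact_sum_lt A B k (A1 _ Ak) below Ak nB; rewrite e ltxx.
- rewrite inE notin_setE => Bk nA _.
  have below' i : (i < k)%N -> B i <-> A i by move=> /below [].
  by have := @fact_sum_lt B A k (B1 _ Bk) below' Bk nA; rewrite e ltxx.
Qed.

(** The crude tail bound 2 / 3`! already keeps the sum below 1. *)
Lemma fact_sum_itv A : A `<=` [set n | 2 < n]%N -> 0 <= fact_sum R A < 1.
Proof.
move=> A3.
have s3 : series (fact_term R A) 3 = 0.
  rewrite /series /= big_nat_cond big1 // => i /andP[/andP[_ i3] _].
  rewrite /fact_term memNset ?mul0r // => /A3 /=; lia.
rewrite -{1}s3 fact_sum_ge /=.
have := @fact_sum_le A 3 isT; rewrite s3 add0r => /le_lt_trans; apply.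
by rewrite ltr_pdivrMr ?ltr0n // mul1r ltr_nat.
Qed.

End FactSum.

(** * Points of the circle *)

Lemma pi_circle_inj (R : realType) (x y : R) : 0 <= x < 1 -> 0 <= y < 1 ->
  \pi_(circle R)%qT x = \pi_(circle R)%qT y -> x = y.
Proof.
move=> /andP[x0 x1] /andP[y0 y1] xy.
have : (x == y %[mod circle R])%qT by apply/eqP.
rewrite -Quotient.idealrBE => /intrP[k kE].
apply/eqP; rewrite -subr_eq0 kE intr_eq0; apply/eqP.
have : (k%:~R : R) < 1%:~R by rewrite -kE; lra.
have : ((-1)%:~R : R) < k%:~R by rewrite -kE rmorphN /=; lra.
by rewrite !ltr_int; lia.
Qed.

Lemma circle_norm_pi_mulz (R : realType) (x : R) (z : int) :
  circle_norm (\pi_(circle R)%qT x *~ z) = dist_int (x *~ z).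
Proof. by rewrite -raddfMz circle_norm_pi. Qed.

(** Outside the blocks preceding an element of A the distances are at most
2 / n.+1, so the indices where they reach e lie in finitely many blocks and in
the sparse ones. *)
Lemma fact_sum_stat_char (R : realType) (A : set nat) :
  A `<=` [set n | exists a, n = 2 ^ a]%N ->
  stat_char_subgroup (fun n : nat => (zeta n)%:Z)
    (\pi_(circle R)%qT (fact_sum R A)).
Proof.
move=> A2 e e0.
apply: (@sparse_blocks_density0 _ _ (Num.truncn (2 / e))) => k j Kk jk kP /=.
rewrite zeta_block // circle_norm_pi_mulz.
apply/negP; rewrite -ltNge.
have /le_lt_trans -> //: dist_int (fact_sum R A *~ (j.+1 * k.+1`!)%N) <= 2 / k.+2%:R.
  by apply: dist_int_fact_sum => // /A2[a /eqP]; exact/negP.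
rewrite ltr_pdivrMr ?ltr0n // mulrC -ltr_pdivrMr //.
by apply: lt_le_trans (truncnS_gt _) _; rewrite ler_nat ltnS leqW.
Qed.

(** The Dedekind cut of x, transported to the powers of 2 by a numbering of the
rationals.  The exponent is shifted so that all elements exceed 2, which keeps
e_A in [0, 1). *)
Definition cut_code {R : realType} (x : R) : set nat :=
  [set n | exists2 q : rat, ratr q < x & n = (2 ^ (pickle q).+2)%N].

Lemma cut_code_inj (R : realType) : injective (@cut_code R).
Proof.
suff H (x y : R) : x < y -> cut_code x <> cut_code y.
  move=> x y xy; case: (ltgtP x y) => // /H; first by [].
  by move=> /(_ (esym xy)).
move=> xy e; have [q] := rat_in_itvoo xy; rewrite in_itv /= => /andP[xq qy].
have : cut_code y (2 ^ (pickle q).+2)%N by exists q.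
rewrite -e => -[p px /eqP]; rewrite eqn_exp2l // => /eqP[/(pcan_inj pickleK) qp].
by move: px; rewrite -qp ltNge (ltW xq).
Qed.

Lemma cut_code_gt2 (R : realType) (x : R) : cut_code x `<=` [set n | 2 < n]%N.
Proof.
by move=> _ [q _ ->] /=; apply: (@leq_trans (2 ^ 2)%N) => //; rewrite leq_pexp2l.
Qed.

Theorem corollary3p3 (R : realType) :
  @stat_char_subgroup R (fun n : nat => (zeta n)%:Z) #= [set: R].
Proof.
have circle_le : [set: circle R] #<= [set: R].
  apply/pcard_injP; exists repr => x y _ _ xy.
  by rewrite -[x]reprK -[y]reprK xy.
apply: Cantor_Bernstein.
  by apply: card_le_trans _ circle_le; exact: subset_card_le.
pose f (x : R) : circle R := \pi_(circle R)%qT (fact_sum R (cut_code x)).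
have f_inj : {in [set: R] &, injective f}.
  move=> x y _ _ /pi_circle_inj fxy; apply: cut_code_inj.
  have gt1 (z : R) : cut_code z `<=` [set n | 1 < n]%N.
    by move=> n /cut_code_gt2 /=; exact: ltnW.
  apply: (fact_sum_inj R _ _ (gt1 x) (gt1 y)).
  by apply: fxy; apply: fact_sum_itv; exact: cut_code_gt2.
have := inj_card_eq f_inj; rewrite card_eq_sym card_eq_le => /andP[le_f _].
apply: card_le_trans le_f _; apply: subset_card_le => _ [x _ <-].
by apply: fact_sum_stat_char => _ [q _ ->]; exists (pickle q).+2.
Qed.
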